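(* Let $\{(\mathbf{x}^{(i)},y^{(i)})\}_{i=1}^n$ with $\|\mathbf{x}^{(i)}\|_2\le1$, $y^{(i)}\in\{-1,1\}$, and suppose there is $\mathbf{w}^*$ with $\|\mathbf{w}^*\|_2=1$ and $\min_iy^{(i)}\mathbf{x}^{(i)\top}\mathbf{w}^*=\gamma>0$. Let $A$ have rows $y^{(i)}\mathbf{x}^{(i)\top}$ and $R(\mathbf{v})=\frac1n\sum_{i=1}^n\exp(-y^{(i)}\mathbf{v}^{\top}\mathbf{x}^{(i)})$. (NAG.) $\mathbf{v}_0=\mathbf{s}_0=\mathbf{0}$; for $t=1,\dots,T$: $\mathbf{u}_t=\mathbf{s}_{t-1}+\frac{1}{2(t-1)}\mathbf{v}_{t-1}$ (with $\mathbf{u}_1=\mathbf{s}_0$), $\mathbf{v}_t=\mathbf{v}_{t-1}-\eta_t\nabla R(\mathbf{u}_t)$ with $\eta_t=\frac{t}{R(\mathbf{u}_t)}$, $\mathbf{s}_t=\mathbf{s}_{t-1}+\frac{1}{2(t+1)}\mathbf{v}_t$. (Game dynamics.) $\alpha_t=t$, $g(\mathbf{w},\mathbf{p})=\mathbf{p}^{\top}A\mathbf{w}-\frac12\|\mathbf{w}\|_2^2$, $\mathbf{w}_0=\mathbf{0}$, $h_j(\mathbf{w})=-g(\mathbf{w},\mathbf{p}_j)$, $\ell_j(\mathbf{p})=g(\mathbf{w}_j,\mathbf{p})$; for $t=1,\dots,T$, first $\mathbf{p}_t=\arg\min_{\mathbf{p}\in\Delta^n}\tfrac14\big[\sum_{s=1}^{t-1}\alpha_s\ell_s(\mathbf{p})+\alpha_t\ell_{t-1}(\mathbf{p})\big]+D_E(\mathbf{p},\tfrac{\mathbf{1}}{n})$,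 then $\mathbf{w}_t=\arg\min_{\mathbf{w}\in\mathbb{R}^d}\sum_{j=1}^t\alpha_jh_j(\mathbf{w})$; let $\overline{\mathbf{w}}_T=\frac{\sum_t\alpha_t\mathbf{w}_t}{\sum_t\alpha_t}$ and $\widetilde{\mathbf{w}}_T=\frac{\sum_{t=1}^T\alpha_t}{4}\overline{\mathbf{w}}_T$. Then $\mathbf{s}_T=\widetilde{\mathbf{w}}_T$, and $\frac{\min_{\mathbf{p}\in\Delta^n}\mathbf{p}^{\top}A\mathbf{s}_T}{\|\mathbf{s}_T\|_2}\ge\gamma-\frac{8\log n+2}{T(T+1)\gamma}$.
   Context: $\Delta^n$ is the probability simplex; $\mathbf{1}$ the all-ones vector; $D_E(\mathbf{p},\mathbf{q})=\sum_ip_i\log(p_i/q_i)$ (KL divergence). Note $\min_{\mathbf{p}\in\Delta^n}\mathbf{p}^{\top}A\mathbf{s}=\min_iy^{(i)}\mathbf{x}^{(i)\top}\mathbf{s}$. *)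

(* Defs.v *)
From HB Require Import structures.
From mathcomp Require Import all_boot all_order all_algebra.
From mathcomp Require Import all_classical all_reals all_analysis.
Set Implicit Arguments. Unset Strict Implicit. Unset Printing Implicit Defensive.
Import Order.TTheory GRing.Theory Num.Theory.
Import numFieldNormedType.Exports.
Local Open Scope ring_scope.

Section Defs.
Variable R : realType.

Definition dotv (d : nat) (u v : 'rV[R]_d) : R := (u *m v^T) 0 0.
Definition norm2 (d : nat) (u : 'rV[R]_d) : R := Num.sqrt (dotv u u).

Definition in_simplex (n : nat) (p : 'rV[R]_n) : Prop :=
  (forall i, 0 <= p 0 i) /\ \sum_i p 0 i = 1.

Definition Amat (n d : nat) (x : 'I_n -> 'rV[R]_d) (y : 'I_n -> R) : 'M[R]_(n, d) :=
  \matrix_(i, j) (y i * x i 0 j).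

Definition pAw (n d : nat) (A : 'M[R]_(n, d)) (p : 'rV[R]_n) (w : 'rV[R]_d) : R :=
  (p *m A *m w^T) 0 0.

Definition exp_risk (n d : nat) (x : 'I_n -> 'rV[R]_d) (y : 'I_n -> R)
  (v : 'rV[R]_d) : R :=
  n%:R^-1 * \sum_i expR (- (y i * dotv v (x i))).

Definition grad (d : nat) (f : 'rV[R]_d -> R) (u : 'rV[R]_d) : 'rV[R]_d :=
  \row_j ('D_(delta_mx 0 j) f u).

Fixpoint nag (n d : nat) (x : 'I_n -> 'rV[R]_d) (y : 'I_n -> R) (t : nat)
  : 'rV[R]_d * 'rV[R]_d :=
  match t with
  | 0 => (0, 0)
  | t'.+1 =>
      let vs := nag x y t' in
      let v := vs.1 in let s := vs.2 in
      let u := if t' == 0%N then s else s + (2 * t'%:R)^-1 *: v in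
      let eta := t%:R / exp_risk x y u in
      let v' := v - eta *: grad (exp_risk x y) u in
      (v', s + (2 * (t.+1)%:R)^-1 *: v')
  end.

(* KL divergence D_E(p, q) = sum_i p_i log(p_i/q_i)  (0 log 0 = 0, as 0 * _ = 0). *)
Definition KL (n : nat) (p q : 'rV[R]_n) : R := \sum_i p 0 i * ln (p 0 i / q 0 i).

Definition unif (n : nat) : 'rV[R]_n := const_mx n%:R^-1.

Definition gfun (n d : nat) (A : 'M[R]_(n, d)) (w : 'rV[R]_d) (p : 'rV[R]_n) : R :=
  pAw A p w - 2^-1 * norm2 w ^+ 2.

Definition alpha (t : nat) : R := t%:R.

Definition p_obj (n d : nat) (A : 'M[R]_(n, d)) (w : nat -> 'rV[R]_d) (t : nat)
  (p : 'rV[R]_n) : R :=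
  4^-1 * (\sum_(1 <= s < t) alpha s * gfun A (w s) p + alpha t * gfun A (w t.-1) p)
  + KL p (unif n).

Definition w_obj (n d : nat) (A : 'M[R]_(n, d)) (p : nat -> 'rV[R]_n) (t : nat)
  (w : 'rV[R]_d) : R :=
  \sum_(1 <= j < t.+1) alpha j * (- gfun A w (p j)).

Definition wbar (d : nat) (w : nat -> 'rV[R]_d) (T : nat) : 'rV[R]_d :=
  (\sum_(1 <= t < T.+1) alpha t)^-1 *: \sum_(1 <= t < T.+1) alpha t *: w t.
Definition wtilde (d : nat) (w : nat -> 'rV[R]_d) (T : nat) : 'rV[R]_d :=
  ((\sum_(1 <= t < T.+1) alpha t) / 4) *: wbar w T.

End Defs.

(* Main.v *)
Require Import Defs.
From HB Require Import structures.
From mathcomp Require Import all_boot all_order all_algebra.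
From mathcomp Require Import all_classical all_reals all_analysis.
From mathcomp Require Import ring lra.
Set Implicit Arguments. Unset Strict Implicit. Unset Printing Implicit Defensive.
Import Order.TTheory GRing.Theory Num.Theory.
Import numFieldNormedType.Exports.
Local Open Scope ring_scope.

(* The minimisers of the game are explicit: [w_t] is the average of the vectors
   [A^T p_j] with weights [j], and [p_t] is the Gibbs distribution of the exponential
   risk [R] at the point [u_t] of NAG, so that [grad R (u_t) = - R (u_t) A^T p_t] and
   both dynamics coincide, with [v_t = (t (t+1) / 2) w_t] and [4 s_t = sum_s s w_s].

   The logarithm of [R] is convex and, by Hoeffding's lemma, 1-smooth.  Comparing [u_t]
   with [s_(t-1)] and [s_t] bounds [ln R (s_T)], hence every margin of [s_T], in terms of
   the payoffs of the game, up to errors [t^2 / 32 |w_t - w_(t-1)|^2].  The w-player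
   plays "be the leader" on strongly convex losses; its negative regret absorbs all
   these errors except the one at [t = 1], which is at most [1 / 32].  Comparing with
   the multiple of [w*] that has the norm of the averaged iterate gives the bound. *)

(** * Scalar inequalities for the exponential: Hoeffding's lemma and Jensen's inequality *)

Lemma ge0_is_derive_ge (R : realType) (f df : R -> R) (x : R) :
  (forall z : R, is_derive z (1 : R) f (df z)) -> (forall z, 0 <= z -> 0 <= df z) ->
  0 <= x -> f 0 <= f x.
Proof.
move=> fd df0 x0.
have dr z : derivable f z 1 by have [] := fd z.
apply: (@ger0_derive1_ndecr _ f 0 x) => //.
- move=> z; rewrite in_itv /= => /andP[z0 _].
  by rewrite derive1E (@derive_val _ _ _ _ _ _ _ (fd z)) df0// ltW.
- apply: continuous_subspaceT => z.
  by apply: differentiable_continuous; apply/derivable1_diffP.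
Qed.

(* With [K x = exp (c x + x^2 / 2) - (cosh x + c sinh x)] one has
   [K'' - K = (c + x)^2 exp (c x + x^2 / 2) >= 0].  Hence [exp x (K' - K)], which is
   the quantity in [N_ge0], and then [g = exp (- x) K] are nondecreasing from 0. *)
Lemma two_point_hoeffding (R : realType) (c x : R) : 0 <= x ->
  (1 + c) / 2 * expR x + (1 - c) / 2 * expR (- x)
    <= expR (c * x + x ^+ 2 / 2).
Proof.
move=> x0.
have N_ge0 z : 0 <= z ->
    0 <= (c + z - 1) * expR ((1 + c) * z + z ^+ 2 / 2) + (1 - c).
  move=> z0.
  pose f z := (c + z - 1) * expR ((1 + c) * z + z ^+ 2 / 2) + (1 - c).
  have -> : 0 = f 0 by rewrite /f mulr0 expr0n/= mul0r !addr0 expR0; ring.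
  apply: (@ge0_is_derive_ge _ f
    (fun z => expR ((1 + c) * z + z ^+ 2 / 2) * (c + z) ^+ 2)) => // u.
  - rewrite /f; apply: is_derive_eq.
    by rewrite /GRing.scale /=; field.
  - by move=> u0; rewrite mulr_ge0 ?expR_ge0 ?sqr_ge0.
pose g z := expR ((c - 1) * z + z ^+ 2 / 2)
            - ((1 + c) / 2 + (1 - c) / 2 * expR (- (2 * z))).
have : g 0 <= g x.
  apply: (@ge0_is_derive_ge _ g (fun z => expR (- (2 * z)) *
    ((c + z - 1) * expR ((1 + c) * z + z ^+ 2 / 2) + (1 - c)))) => // u.
  - rewrite /g; apply: is_derive_eq.
    have -> : (1 + c) * u + u ^+ 2 / 2 = 2 * u + ((c - 1) * u + u ^+ 2 / 2) by ring.
    rewrite !expRD /GRing.scale /= expRN.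
    field; exact: lt0r_neq0 (expR_gt0 _).
  - by move=> u0; rewrite mulr_ge0 ?expR_ge0 ?N_ge0.
have -> : g 0 = 0 by rewrite /g !mulr0 expr0n/= mul0r addr0 oppr0 expR0; field.
rewrite -(pmulr_rge0 _ (expR_gt0 x)) /g.
have -> : c * x + x ^+ 2 / 2 = x + ((c - 1) * x + x ^+ 2 / 2) by ring.
rewrite [expR (x + _)]expRD.
have -> : - (2 * x) = - x + - x by ring.
rewrite [expR (- x + _)]expRD mulrBr subr_ge0; congr (_ <= _).
rewrite expRN; field; exact: lt0r_neq0 (expR_gt0 _).
Qed.

(** Tangents at [z] bound exp at [M] and at [- M] from below; averaging them with the weights
    [(1 + z / M) / 2] and [(1 - z / M) / 2], of mean [z], cancels the slope. *)
Lemma expR_chord_le (R : realType) (M z : R) : 0 < M -> `|z| <= M ->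
  expR z <= (1 + z / M) / 2 * expR M + (1 - z / M) / 2 * expR (- M).
Proof.
move=> M0; rewrite ler_norml => /andP[zl zr].
have zM1 : z / M <= 1 by rewrite ler_pdivrMr// mul1r.
have zM2 : -1 <= z / M by rewrite ler_pdivlMr// mulN1r.
have tangent b : expR z * (1 + (b - z)) <= expR b.
  have -> : expR b = expR z * expR (b - z) by rewrite -expRD; congr expR; ring.
  by rewrite ler_pM2l ?expR_gt0// expR_ge1Dx.
set k := z / M in zM1 zM2 *; have zE : z = k * M by rewrite /k divfK ?gt_eqF.
have t1 : (1 + k) / 2 * (expR z * (1 + (M - z))) <= (1 + k) / 2 * expR M.
  by apply: ler_wpM2l (tangent M); lra.
have t2 : (1 - k) / 2 * (expR z * (1 + (- M - z))) <= (1 - k) / 2 * expR (- M).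
  by apply: ler_wpM2l (tangent (- M)); lra.
apply: le_trans (lerD t1 t2).
suff -> : (1 + k) / 2 * (expR z * (1 + (M - z))) +
  (1 - k) / 2 * (expR z * (1 + (- M - z))) = expR z by [].
by rewrite [in X in 1 + (M - X)]zE [in X in 1 + (- M - X)]zE; field.
Qed.

(** The chord over [[- M, M]] is affine in [z i], so averaging leaves a two-point law on [- M] and
    [M] with the same mean [m]; [two_point_hoeffding] then applies with [c = m / M]. *)
Lemma hoeffding_finite (R : realType) (n : nat) (p z : 'I_n -> R) (M : R) :
  (forall i, 0 <= p i) -> \sum_i p i = 1 -> (forall i, `|z i| <= M) ->
  \sum_i p i * expR (z i) <= expR (\sum_i p i * z i + M ^+ 2 / 2).
Proof.
move=> p0 p1 zM.
have M0 : 0 <= M.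
  case: n p z p0 p1 zM => [|n] p z _ p1 zM; last exact: le_trans (zM ord0).
  by move: p1; rewrite big_ord0 => /esym/eqP; rewrite oner_eq0.
move: M0; rewrite le_eqVlt => /predU1P[M0|M0].
  have z0 i : z i = 0 by apply/eqP; rewrite -normr_le0 M0.
  under eq_bigr do rewrite z0 expR0 mulr1.
  under [in leRHS]eq_bigr do rewrite z0 mulr0.
  by rewrite p1 big1// -M0 expr0n/= mul0r addr0 expR0.
set m := \sum_i p i * z i.
have -> : m + M ^+ 2 / 2 = m / M * M + M ^+ 2 / 2 by rewrite divfK ?gt_eqF.
apply: le_trans (two_point_hoeffding (m / M) (ltW M0)).
apply: (@le_trans _ _ (\sum_i p i *
    ((1 + z i / M) / 2 * expR M + (1 - z i / M) / 2 * expR (- M)))).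
  by apply: ler_sum => i _; rewrite ler_wpM2l// expR_chord_le.
rewrite le_eqVlt; apply/orP; left; apply/eqP.
transitivity (\sum_i (p i * ((expR M + expR (- M)) / 2)
   + p i * z i * ((expR M - expR (- M)) / (2 * M)))).
  by apply: eq_bigr => i _; field; rewrite gt_eqF.
rewrite big_split/= -!mulr_suml p1 -/m.
by field; rewrite gt_eqF.
Qed.

Lemma jensen_expR (R : realType) (n : nat) (p z : 'I_n -> R) :
  (forall i, 0 <= p i) -> \sum_i p i = 1 ->
  expR (\sum_i p i * z i) <= \sum_i p i * expR (z i).
Proof.
move=> p0 p1; set m := \sum_i p i * z i.
apply: (@le_trans _ _ (\sum_i p i * (expR m * (1 + (z i - m))))).
  rewrite le_eqVlt; apply/orP; left; apply/eqP.
  transitivity (expR m * ((1 - m) * \sum_i p i + m)); first by rewrite p1; ring.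
  rewrite /m mulr_sumr -big_split/= mulr_sumr -/m.
  by apply: eq_bigr => i _; ring.
apply: ler_sum => i _; rewrite ler_wpM2l//.
have -> : expR (z i) = expR m * expR (z i - m).
  by rewrite -expRD; congr expR; ring.
by rewrite ler_pM2l ?expR_gt0// expR_ge1Dx.
Qed.

(** * Euclidean inner product and the Cauchy-Schwarz inequality *)

Section DotProduct.
Variables (R : realType) (d : nat).
Implicit Types u v z : 'rV[R]_d.

Lemma dotvE u v : dotv u v = \sum_j u 0 j * v 0 j.
Proof. by rewrite /dotv mxE; apply: eq_bigr => j _; rewrite mxE. Qed.

Lemma dotvC u v : dotv u v = dotv v u.
Proof. by rewrite !dotvE; apply: eq_bigr => j _; rewrite mulrC. Qed.

Lemma dotvDl u v z : dotv (u + v) z = dotv u z + dotv v z.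
Proof. by rewrite /dotv mulmxDl mxE. Qed.

Lemma dotvZl (a : R) u v : dotv (a *: u) v = a * dotv u v.
Proof. by rewrite /dotv -scalemxAl mxE. Qed.

Lemma dotvNl u v : dotv (- u) v = - dotv u v.
Proof. by rewrite -scaleN1r dotvZl mulN1r. Qed.

Lemma dotvDr u v z : dotv u (v + z) = dotv u v + dotv u z.
Proof. by rewrite dotvC dotvDl !(dotvC u). Qed.

Lemma dotvZr (a : R) u v : dotv u (a *: v) = a * dotv u v.
Proof. by rewrite dotvC dotvZl (dotvC u). Qed.

Lemma dotvNr u v : dotv u (- v) = - dotv u v.
Proof. by rewrite dotvC dotvNl (dotvC u). Qed.

Lemma dot0v v : dotv 0 v = 0.
Proof. by rewrite -(scale0r v) dotvZl mul0r. Qed.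

Lemma dotv0 v : dotv v 0 = 0.
Proof. by rewrite dotvC dot0v. Qed.

Lemma dotv_suml (I : Type) (r : seq I) (P : pred I) (F : I -> 'rV[R]_d) v :
  dotv (\sum_(i <- r | P i) F i) v = \sum_(i <- r | P i) dotv (F i) v.
Proof.
by elim/big_rec2: _ => [|i y1 y2 _ <-]; rewrite ?dot0v ?dotvDl.
Qed.

Lemma dotvv_ge0 v : 0 <= dotv v v.
Proof. by rewrite dotvE; apply: sumr_ge0 => j _; rewrite -expr2 sqr_ge0. Qed.

Lemma dotvv_eq0 v : dotv v v = 0 -> v = 0.
Proof.
rewrite dotvE => /eqP; rewrite psumr_eq0 => [/allP v0|j _].
  apply/rowP => j; rewrite mxE; have := v0 j; rewrite mem_index_enum.
  by move=> /(_ isT)/=; rewrite -expr2 sqrf_eq0 => /eqP.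
by rewrite -expr2 sqr_ge0.
Qed.

Lemma norm2_ge0 v : 0 <= norm2 v.
Proof. exact: sqrtr_ge0. Qed.

Lemma sqr_norm2 v : norm2 v ^+ 2 = dotv v v.
Proof. by rewrite sqr_sqrtr// dotvv_ge0. Qed.

Lemma norm2Z (a : R) v : 0 <= a -> norm2 (a *: v) = a * norm2 v.
Proof.
move=> a0; rewrite /norm2 dotvZl dotvZr mulrA -expr2 sqrtrM ?sqr_ge0//.
by rewrite sqrtr_sqr ger0_norm.
Qed.

Lemma dotv_le_norm2 u v : dotv u v <= norm2 u * norm2 v.
Proof.
have := dotvv_ge0 (norm2 v *: u - norm2 u *: v).
rewrite !(dotvDl, dotvDr, dotvNl, dotvNr, dotvZl, dotvZr) -!sqr_norm2.
rewrite (dotvC v u) => H.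
have {}H : norm2 u * norm2 v * dotv u v <= (norm2 u * norm2 v) ^+ 2 by nra.
have := norm2_ge0 u; rewrite le_eqVlt => /predU1P[u0|u0].
  rewrite -u0 mul0r (@dotvv_eq0 u) ?dot0v//.
  by rewrite -sqr_norm2 -u0 expr0n.
have := norm2_ge0 v; rewrite le_eqVlt => /predU1P[v0|v0].
  rewrite -v0 mulr0 (@dotvv_eq0 v) ?dotv0//.
  by rewrite -sqr_norm2 -v0 expr0n.
by move: H; rewrite expr2 ler_pM2l ?mulr_gt0.
Qed.

Lemma norm_dotv_le u v : norm2 u <= 1 -> `|dotv u v| <= norm2 v.
Proof.
move=> u1; have v0 := norm2_ge0 v.
have uv : norm2 u * norm2 v <= norm2 v by rewrite ler_piMl.
rewrite ler_norml (le_trans (dotv_le_norm2 _ _) uv) andbT.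
rewrite lerNl -dotvNr (le_trans (dotv_le_norm2 _ _))//.
by rewrite /norm2 dotvNl dotvNr opprK.
Qed.

End DotProduct.

(** * Softmin distributions as entropic minimisers *)

Section ExpRisk.
Variables (R : realType) (n d : nat).
Variables (x : 'I_n -> 'rV[R]_d) (y : 'I_n -> R).
Hypothesis n_gt0 : (0 < n)%N.

Definition softmin (z : 'I_n -> R) : 'rV[R]_n :=
  \row_i (expR (- z i) / \sum_k expR (- z k)).

Lemma sum_expR_gt0 (z : 'I_n -> R) : 0 < \sum_k expR (z k).
Proof.
rewrite (bigD1 (Ordinal n_gt0))//= ltr_pwDl ?expR_gt0//.
by apply: sumr_ge0 => k _; rewrite expR_ge0.
Qed.

Lemma softmin_gt0 (z : 'I_n -> R) i : 0 < softmin z 0 i.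
Proof. by rewrite mxE divr_gt0 ?expR_gt0// sum_expR_gt0. Qed.

Lemma softmin_simplex (z : 'I_n -> R) : in_simplex (softmin z).
Proof.
split=> [i|]; first by rewrite ltW// softmin_gt0.
under eq_bigr do rewrite mxE.
by rewrite -mulr_suml divff// gt_eqF// sum_expR_gt0.
Qed.

(** For [a > 0] this is [1 + r <= exp r] at [r = - ln (a / b)], multiplied by [a]. It is the
    termwise form of the nonnegativity of KL. *)
Lemma xlnx_ge (a b : R) : 0 <= a -> 0 < b -> a - b <= a * ln (a / b).
Proof.
move=> a0 b0; move: a0; rewrite le_eqVlt => /predU1P[<-|a0].
  by rewrite mul0r sub0r oppr_le0 ltW.
have := expR_ge1Dx (- ln (a / b)).
rewrite expRN lnK ?posrE ?divr_gt0// invf_div => H.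
have : a * (1 - ln (a / b)) <= a * (b / a) by rewrite ler_pM2l.
by rewrite mulrCA divff ?gt_eqF// mulr1; lra.
Qed.

(** Strictness of [1 + r < exp r] for nonzero [r]; this gives uniqueness of the entropic
    minimiser. *)
Lemma xlnx_eq (a b : R) : 0 <= a -> 0 < b -> a * ln (a / b) = a - b -> a = b.
Proof.
move=> a0 b0; move: a0; rewrite le_eqVlt => /predU1P[<-|a0].
  by rewrite mul0r sub0r => /eqP; rewrite eq_sym oppr_eq0 => /eqP.
move=> H; have [l0|/negPf l0] := eqVneq (ln (a / b)) 0.
  by move: H; rewrite l0 mulr0 => /esym/eqP; rewrite subr_eq0 => /eqP.
have := @expR_gt1Dx _ (- ln (a / b)); rewrite oppr_eq0 l0 => /(_ isT).
rewrite expRN lnK ?posrE ?divr_gt0// invf_div -(ltr_pM2l a0).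
by rewrite mulrCA divff ?gt_eqF// mulr1 mulrDr mulr1 mulrN H; lra.
Qed.

(** On the simplex the objective is the divergence of [q] from [softmin z] plus a constant, so a
    minimiser has divergence at most 0. *)
Lemma entropic_argmin (z : 'I_n -> R) (p : 'rV[R]_n) : in_simplex p ->
  (forall q, in_simplex q ->
    \sum_i p 0 i * z i + KL p (unif R n) <= \sum_i q 0 i * z i + KL q (unif R n)) ->
  p = softmin z.
Proof.
move=> [p0 p1] /(_ _ (softmin_simplex z)).
set r := softmin z; have r0 i : 0 < r 0 i by exact: softmin_gt0.
have [_ r1] := softmin_simplex z; rewrite -/r in r1.
set Z := \sum_k expR (- z k); have Z0 : 0 < Z by exact: sum_expR_gt0.
have nR0 : (0 : R) < n%:R by rewrite ltr0n.
have objE q : in_simplex q -> \sum_i q 0 i * z i + KL q (unif R n) =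
    \sum_i q 0 i * ln (q 0 i / r 0 i) + (ln n%:R - ln Z).
  move=> [q0 q1].
  set K := ln _ - _.
  rewrite -[K]mul1r -q1 mulr_suml -!big_split/=.
  apply: eq_bigr => i _; rewrite /unif mxE.
  have := q0 i; rewrite le_eqVlt => /predU1P[<-|qi0]; first by rewrite !mul0r !addr0.
  rewrite !ln_div ?posrE ?invr_gt0// lnV ?posrE// !mxE ln_div ?posrE ?expR_gt0//.
  by rewrite expRK -/Z /K; ring.
rewrite !objE//; last by split=> // i; exact: ltW.
rewrite lerD2r.
have -> : \sum_i r 0 i * ln (r 0 i / r 0 i) = 0.
  by apply: big1 => i _; rewrite divff ?gt_eqF// ln1 mulr0.
move=> H; apply/rowP => i; apply: xlnx_eq => //.
(* Subtracting [p 0 k - r 0 k] does not change the total, but makes each term nonnegative, hence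
   zero. *)
pose f k := p 0 k * ln (p 0 k / r 0 k) - (p 0 k - r 0 k).
have f0 k : true -> 0 <= f k by rewrite subr_ge0 xlnx_ge.
have : \sum_k f k == 0.
  rewrite eq_le sumr_ge0// andbT /f !sumrB p1 r1; lra.
rewrite psumr_eq0// => /allP/(_ i); rewrite mem_index_enum => /(_ isT)/=.
by rewrite subr_eq0 => /eqP.
Qed.

(** * Gradient of the risk; convexity and smoothness of its logarithm *)

Definition gibbs (u : 'rV[R]_d) : 'rV[R]_n := softmin (fun i => y i * dotv u (x i)).

Lemma dotv_mul_Amat (q : 'rV[R]_n) (v : 'rV[R]_d) :
  dotv (q *m Amat x y) v = \sum_i q 0 i * (y i * dotv v (x i)).
Proof.
rewrite /dotv -mulmxA mxE; apply: eq_bigr => i _; congr (_ * _).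
rewrite !mxE mulr_sumr; apply: eq_bigr => j _.
by rewrite !mxE mulrAC mulrA.
Qed.

Lemma exp_risk_gt0 u : 0 < exp_risk x y u.
Proof. by rewrite mulr_gt0 ?invr_gt0 ?ltr0n// sum_expR_gt0. Qed.

(** The ratio of risks is a mean of exponentials under the Gibbs law at [u], to which Jensen's
    inequality and Hoeffding's lemma apply. *)
Lemma exp_risk_ratio u v : exp_risk x y v = exp_risk x y u *
  \sum_i gibbs u 0 i * expR (- (y i * dotv (v - u) (x i))).
Proof.
rewrite /exp_risk -mulrA; congr (_ * _); rewrite mulr_sumr.
apply: eq_bigr => i _; rewrite mxE mulrA mulrCA divff ?gt_eqF ?sum_expR_gt0//.
by rewrite mulr1 -expRD dotvDl dotvNl; congr expR; ring.
Qed.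

Lemma is_derive_expR_affine (a b h : R) :
  is_derive h 1 (fun k => expR (k * b + a)) (b * expR (h * b + a)).
Proof. by apply: is_derive_eq; rewrite /GRing.scale/=; ring. Qed.

Lemma grad_exp_risk u :
  grad (exp_risk x y) u = - (exp_risk x y u *: (gibbs u *m Amat x y)).
Proof.
apply/rowP => j; rewrite !mxE.
pose g i := fun h : R => expR (h * - (y i * x i 0 j) + - (y i * dotv u (x i))).
(* The directional derivative becomes the derivative at 0 of a finite sum of exponentials of affine
   functions of one variable. *)
have -> : 'D_(delta_mx 0 j) (exp_risk x y) u =
    'D_1 (fun h => n%:R^-1 * (\sum_i g i) h) (0 : R).
  have E k : exp_risk x y (k *: delta_mx 0 j + u) = n%:R^-1 * (\sum_i g i) k.
    rewrite /exp_risk fct_sumE; congr (_ * _); apply: eq_bigr => i _.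
    have e1 : dotv (delta_mx 0 j) (x i) = x i 0 j.
      rewrite dotvE (bigD1 j)//= mxE !eqxx mul1r big1 ?addr0// => k0 kj.
      by rewrite mxE eqxx (negPf kj) mul0r.
    by rewrite /g dotvDl dotvZl e1; congr expR; ring.
  rewrite /derive; apply: (congr1 (fun f => lim (f @ 0^')%classic)).
  apply/funext => h /=.
  by rewrite -!E scale0r add0r [h *: 1]mulr1 addr0.
have gd i : is_derive (0 : R) 1 (g i)
    (- (y i * x i 0 j) * expR (- (y i * dotv u (x i)))).
  by have := is_derive_expR_affine (- (y i * dotv u (x i))) (- (y i * x i 0 j)) 0;
    rewrite mul0r add0r.
have gs := @is_derive_sum _ _ _ _ _ _ _ _ gd.
rewrite derive_val /exp_risk -mulrA -mulrN; congr (_ * _).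
rewrite mulr_sumr -sumrN; apply: eq_bigr => i _; rewrite !mxE.
by field; rewrite gt_eqF// sum_expR_gt0.
Qed.

Lemma ln_exp_risk_ge_tangent u v :
  ln (exp_risk x y u) - dotv (gibbs u *m Amat x y) (v - u) <= ln (exp_risk x y v).
Proof.
rewrite -[X in _ + X]expRK -lnM ?posrE ?exp_risk_gt0 ?expR_gt0//.
rewrite ler_ln ?posrE ?exp_risk_gt0//;
  last by apply: mulr_gt0; [exact: exp_risk_gt0 | exact: expR_gt0].
rewrite (exp_risk_ratio u v) ler_pM2l ?exp_risk_gt0//.
have [g0 g1] := softmin_simplex (fun i => y i * dotv u (x i)).
rewrite dotv_mul_Amat -sumrN; under eq_bigr do rewrite -mulrN.
exact: jensen_expR.
Qed.

(** Hoeffding's lemma with [M = norm2 (v - u)], which bounds every exponent of the ratio by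
    Cauchy-Schwarz. *)
Lemma ln_exp_risk_le_quadratic u v :
  (forall i, norm2 (x i) <= 1) -> (forall i, y i = 1 \/ y i = -1) ->
  ln (exp_risk x y v) <= ln (exp_risk x y u)
    + (dotv (v - u) (v - u) / 2 - dotv (gibbs u *m Amat x y) (v - u)).
Proof.
move=> x1 y1; rewrite addrC -[X in X + _]expRK.
rewrite -lnM ?posrE ?exp_risk_gt0 ?expR_gt0// ler_ln ?posrE ?exp_risk_gt0//;
  last by apply: mulr_gt0; [exact: expR_gt0 | exact: exp_risk_gt0].
rewrite mulrC [_ / 2 - _]addrC (exp_risk_ratio u v) ler_pM2l ?exp_risk_gt0//.
have [g0 g1] := softmin_simplex (fun i => y i * dotv u (x i)).
rewrite dotv_mul_Amat -sumrN; under [in leRHS]eq_bigr do rewrite -mulrN.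
rewrite -sqr_norm2; apply: hoeffding_finite => // i.
rewrite normrN dotvC.
by case: (y1 i) => ->; rewrite ?mul1r ?mulN1r ?normrN norm_dotv_le.
Qed.

Lemma ln_exp_risk_ge_margin v i :
  - (y i * dotv v (x i)) - ln n%:R <= ln (exp_risk x y v).
Proof.
rewrite /exp_risk lnM ?posrE ?invr_gt0 ?ltr0n ?sum_expR_gt0//.
rewrite lnV ?posrE ?ltr0n// addrC lerD2l -[leLHS]expRK.
rewrite ler_ln ?posrE ?expR_gt0 ?sum_expR_gt0//.
by rewrite (bigD1 i)//= lerDl sumr_ge0// => k _; exact: expR_ge0.
Qed.

End ExpRisk.

(** * Closed forms for the objectives of the two players *)

Section GameDynamics.
Variables (R : realType) (n d : nat).
Variables (A : 'M[R]_(n, d)) (p : nat -> 'rV[R]_n) (w : nat -> 'rV[R]_d).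

Definition tri (t : nat) : R := t%:R * t.+1%:R / 2.

Lemma triS t : tri t.+1 = tri t + t.+1%:R.
Proof. by rewrite /tri -(natr1 t.+1) -(natr1 t); field. Qed.

Lemma tri_gt0 t : (0 < t)%N -> 0 < tri t.
Proof. by move=> t0; rewrite /tri divr_gt0// mulr_gt0 ?ltr0n. Qed.

Lemma sum_natr t : \sum_(1 <= s < t.+1) (s%:R : R) = tri t.
Proof.
elim: t => [|t IH]; first by rewrite big_geq// /tri !mul0r.
by rewrite big_nat_recr//= IH triS.
Qed.

(** Under the dynamics this is both the NAG vector [v_t] and [tri t *: w t]. *)
Definition pull (t : nat) : 'rV[R]_d := \sum_(1 <= j < t.+1) j%:R *: (p j *m A).

Definition wsum (t : nat) : 'rV[R]_d := \sum_(1 <= s < t.+1) s%:R *: w s.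

Lemma pullS t : pull t.+1 = pull t + t.+1%:R *: (p t.+1 *m A).
Proof. by rewrite /pull big_nat_recr. Qed.

Lemma wsumS t : wsum t.+1 = wsum t + t.+1%:R *: w t.+1.
Proof. by rewrite /wsum big_nat_recr. Qed.

Lemma pull0 : pull 0 = 0. Proof. by rewrite /pull big_geq. Qed.
Lemma wsum0 : wsum 0 = 0. Proof. by rewrite /wsum big_geq. Qed.

Lemma w_objE t v : w_obj A p t v = tri t / 2 * dotv v v - dotv (pull t) v.
Proof.
rewrite -sum_natr !mulr_suml dotv_suml -sumrB; apply: eq_bigr => j _.
by rewrite /gfun /alpha sqr_norm2 dotvZl -[pAw A (p j) v]/(dotv (p j *m A) v); field.
Qed.

(** Against the candidate [pull t / tri t], the excess objective of [z] times [2 * tri t] is the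
    squared norm of [tri t *: z - pull t]. *)
Lemma w_argmin t z : (0 < t)%N ->
  (forall v, w_obj A p t z <= w_obj A p t v) -> tri t *: z = pull t.
Proof.
move=> t0 /(_ ((tri t)^-1 *: pull t)); have S0 := tri_gt0 t0.
rewrite !w_objE !(dotvZl, dotvZr) => H.
apply/eqP; rewrite -subr_eq0; apply/eqP/dotvv_eq0/eqP.
rewrite eq_le dotvv_ge0 andbT.
rewrite !(dotvDl, dotvDr, dotvNl, dotvNr, dotvZl, dotvZr) (dotvC z).
move: H; set a := dotv z z; set b := dotv (pull t) z.
set c := dotv (pull t) (pull t) => H.
rewrite [leLHS](_ : _ = 2 * tri t * ((tri t / 2 * a - b) -
   (tri t / 2 * ((tri t)^-1 * ((tri t)^-1 * c)) - (tri t)^-1 * c))); last first.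
  by field; rewrite gt_eqF.
by rewrite mulr_ge0_le0 ?subr_le0// mulr_ge0// ltW.
Qed.

Lemma w_obj_shift t z v : tri t *: z = pull t ->
  w_obj A p t v = w_obj A p t z + tri t / 2 * dotv (v - z) (v - z).
Proof.
move=> E; rewrite !w_objE -E.
rewrite !(dotvDl, dotvDr, dotvNl, dotvNr, dotvZl, dotvZr) (dotvC v z).
by field.
Qed.

(** An equality, since the losses are quadratic: moving from the minimiser [w t] to [w t.+1] raises
    the first [t] losses by exactly [tri t / 2] times the squared distance. *)
Lemma be_the_leader T : (forall t, (t <= T)%N -> tri t *: w t = pull t) ->
  w_obj A p T (w T) =
  \sum_(0 <= t < T) (t.+1%:R * (dotv (w t.+1) (w t.+1) / 2
                                - dotv (p t.+1 *m A) (w t.+1))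
    + tri t / 2 * dotv (w t.+1 - w t) (w t.+1 - w t)).
Proof.
elim: T => [|T IH] E; first by rewrite w_objE pull0 dot0v /tri big_geq// !mul0r subr0.
rewrite big_nat_recr//= -IH => [|t tT]; last by rewrite E// ltnW.
rewrite addrCA addrC -w_obj_shift ?E//.
by rewrite !w_objE triS pullS dotvDl dotvZl; field.
Qed.

(** The squared norms do not depend on [q], which leaves an entropic problem with a linear payoff;
    the optimistic guess [w t] supplies the momentum term. *)
Lemma p_objE t q : p_obj A w t.+1 q =
  dotv (q *m A) (4^-1 *: (wsum t + t.+1%:R *: w t)) + KL q (unif R n)
  - 4^-1 * (\sum_(1 <= s < t.+1) s%:R * (2^-1 * norm2 (w s) ^+ 2)
            + t.+1%:R * (2^-1 * norm2 (w t) ^+ 2)).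
Proof.
rewrite /p_obj /gfun /alpha dotvZr dotvDr (dotvC _ (wsum t)) dotv_suml dotvZr.
under eq_bigr do rewrite mulrBr.
rewrite sumrB -[pAw A q (w t)]/(dotv (q *m A) (w t)).
under [X in _ = 4^-1 * (X + _) + _ - _]eq_bigr do rewrite dotvZl dotvC.
rewrite /=; ring.
Qed.

End GameDynamics.

(** * NAG as game dynamics, and the bound on the risk *)

Section Margin.
Variables (R : realType) (n d : nat) (x : 'I_n -> 'rV[R]_d) (y : 'I_n -> R).
Variables (T : nat) (p : nat -> 'rV[R]_n) (w : nat -> 'rV[R]_d).
Hypothesis n_gt0 : (0 < n)%N.
Hypothesis x_le1 : forall i, norm2 (x i) <= 1.
Hypothesis y_sign : forall i, y i = 1 \/ y i = -1.
Hypothesis w0 : w 0%N = 0.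
Hypothesis p_simplex : forall t, (t < T)%N -> in_simplex (p t.+1).
Hypothesis p_min : forall t, (t < T)%N -> forall q, in_simplex q ->
  p_obj (Amat x y) w t.+1 (p t.+1) <= p_obj (Amat x y) w t.+1 q.
Hypothesis w_min : forall t, (t < T)%N -> forall v,
  w_obj (Amat x y) p t.+1 (w t.+1) <= w_obj (Amat x y) p t.+1 v.

Let A := Amat x y.
Let s t := 4^-1 *: wsum w t.
(** Shifted index: [u t] is the NAG point [u_(t+1)]. *)
Let u t := 4^-1 *: (wsum w t + t.+1%:R *: w t).

Lemma game_w t : (t <= T)%N -> tri R t *: w t = pull A p t.
Proof.
case: t => [|t] tT; first by rewrite w0 scaler0 pull0.
by apply: w_argmin => // v; exact: w_min.
Qed.

Lemma game_p t : (t < T)%N -> p t.+1 = gibbs x y (u t).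
Proof.
move=> tT; apply: entropic_argmin => //; first exact: p_simplex.
move=> q sq; have := p_min tT sq.
by rewrite !p_objE lerD2r !dotv_mul_Amat.
Qed.

Lemma nag_game t : (t <= T)%N -> nag x y t = (pull A p t, s t).
Proof.
elim: t => [|t IH] tT; first by rewrite /= pull0 /s wsum0 scaler0.
have {}IH := IH (ltnW tT).
(* As [v_t = tri t *: w t], the momentum [v_t / (2 t)] is [w t] scaled by [(t + 1) / 4]; the case
   [t = 0] agrees because [w 0 = 0]. *)
have uE : (if t == 0%N then s t else s t + (2 * t%:R)^-1 *: pull A p t) = u t.
  rewrite /u /s; case: eqP => [->|/eqP t0]; first by rewrite w0 scaler0 addr0.
  rewrite -game_w 1?ltnW// scalerDr !scalerA; congr (_ + _ *: _).
  by rewrite /tri; field; rewrite pnatr_eq0.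
rewrite /= IH /= uE.
(* The step size cancels the factor [R (u t)] of the gradient, leaving the weight [t + 1]. *)
have vE : pull A p t - (t.+1%:R / exp_risk x y (u t)) *: grad (exp_risk x y) (u t)
    = pull A p t.+1.
  rewrite grad_exp_risk// pullS scalerN opprK scalerA divfK; last first.
    by rewrite gt_eqF// exp_risk_gt0.
  by rewrite game_p.
rewrite vE -game_w// /s wsumS scalerDr !scalerA; congr (_, _ + _ *: _).
by rewrite /tri; field; rewrite -natrD pnatr_eq0.
Qed.

(** In each round convexity compares [u t] with [s t], and smoothness compares it with [s t.+1]; the
    payoffs of [w t] cancel. *)
Lemma ln_exp_risk_le t : (t <= T)%N -> ln (exp_risk x y (s t)) <=
  \sum_(0 <= k < t) (k.+1%:R ^+ 2 / 32 * dotv (w k.+1 - w k) (w k.+1 - w k)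
    - k.+1%:R / 4 * dotv (p k.+1 *m A) (w k.+1)).
Proof.
elim: t => [|t IH] tT.
  rewrite big_geq// /s wsum0 scaler0 /exp_risk.
  under eq_bigr do rewrite dot0v mulr0 oppr0 expR0.
  by rewrite sumr_const card_ord mulVf ?ln1// pnatr_eq0 -lt0n.
rewrite big_nat_recr//=; apply: le_trans (lerD (IH (ltnW tT)) (lexx _)).
have lo := ln_exp_risk_ge_tangent x y n_gt0 (u t) (s t).
have hi := ln_exp_risk_le_quadratic n_gt0 (u t) (s t.+1) x_le1 y_sign.
have su : s t - u t = - (t.+1%:R / 4) *: w t.
  by rewrite /s /u scalerDr opprD addrA subrr add0r scalerA mulrC scaleNr.
have su1 : s t.+1 - u t = (t.+1%:R / 4) *: (w t.+1 - w t).
  rewrite /s /u wsumS -scalerBr opprD addrACA subrr add0r -scalerBr scalerA.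
  by rewrite mulrC.
move: lo hi; rewrite su su1 -game_p// -/A.
set D := w t.+1 - w t.
have -> : dotv (p t.+1 *m A) ((t.+1%:R / 4) *: D) = t.+1%:R / 4 *
    (dotv (p t.+1 *m A) (w t.+1) - dotv (p t.+1 *m A) (w t)).
  by rewrite dotvZr dotvDr dotvNr.
rewrite !(dotvZl, dotvZr).
move: (dotv D D) (ln _) (ln _) (ln _) (dotv _ _) (dotv _ _) (t.+1%:R : R).
by clear => D' a b c e f k lo hi; lra.
Qed.

(** * Regret against the separator and the margin bound *)

Variables (wstar : 'rV[R]_d) (gamma : R).
Hypothesis wstar1 : norm2 wstar = 1.
Hypothesis margin : forall i, gamma <= y i * dotv (x i) wstar.
Hypothesis gamma_gt0 : 0 < gamma.
Hypothesis T_gt0 : (0 < T)%N.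

Lemma pull_wstar t : (t <= T)%N -> tri R t * gamma <= dotv (pull A p t) wstar.
Proof.
elim: t => [|t IH] tT; first by rewrite pull0 dot0v /tri !mul0r.
rewrite pullS dotvDl dotvZl triS mulrDl lerD ?IH 1?ltnW// ler_wpM2l//.
have [p0 p1] := p_simplex tT.
rewrite dotv_mul_Amat -[gamma]mul1r -p1 mulr_suml; apply: ler_sum => i _.
by rewrite ler_wpM2l// dotvC.
Qed.

Lemma w_wstar t : (0 < t <= T)%N -> gamma <= dotv (w t) wstar.
Proof.
move=> /andP[t0 tT]; rewrite -(ler_pM2l (tri_gt0 R t0)) -dotvZl game_w//.
exact: pull_wstar.
Qed.

(** Pairing with the unit vector [wstar] bounds the denominator of the normalised margin from
    below. *)
Lemma wsum_norm_ge : tri R T * gamma <= norm2 (wsum w T).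
Proof.
apply: (@le_trans _ _ (dotv (wsum w T) wstar)); last first.
  by apply: le_trans (dotv_le_norm2 _ _) _; rewrite wstar1 mulr1.
rewrite dotv_suml -sum_natr mulr_suml; apply: ler_sum_nat => t tT.
by rewrite dotvZl ler_wpM2l// w_wstar.
Qed.

(** Convexity of the squared norm: each term lies above its tangent at the weighted average [z]. *)
Lemma sum_sqr_w_ge : dotv (wsum w T) (wsum w T) / (2 * tri R T) <=
  \sum_(0 <= t < T) t.+1%:R * (dotv (w t.+1) (w t.+1) / 2).
Proof.
set B := wsum w T; have S0 := tri_gt0 R T_gt0.
pose z := (tri R T)^-1 *: B.
have -> : dotv B B / (2 * tri R T) = dotv B z - tri R T * (dotv z z / 2).
  by rewrite /z !(dotvZl, dotvZr); field; rewrite gt_eqF.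
rewrite /B dotv_suml -sum_natr mulr_suml -sumrB big_add1/=.
apply: ler_sum => t _; rewrite dotvZl -mulrBr ler_wpM2l//.
have := dotvv_ge0 (w t.+1 - z).
rewrite !(dotvDl, dotvDr, dotvNl, dotvNr) (dotvC z); lra.
Qed.

(** Since [w 1] is a convex combination of rows of [A], pairing it with itself gives
    [norm2 (w 1) ^+ 2 <= norm2 (w 1)]. *)
Lemma norm_w1_le : dotv (w 1%N) (w 1%N) <= 1.
Proof.
have := game_w T_gt0; rewrite pullS pull0 add0r scale1r.
have -> : tri R 1 = 1 by rewrite /tri; field.
rewrite scale1r => w1.
have [p0 p1] := p_simplex T_gt0.
have le1 : norm2 (w 1%N) ^+ 2 <= norm2 (w 1%N).
  rewrite sqr_norm2 {1}w1 dotv_mul_Amat -[leRHS]mul1r -p1 mulr_suml.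
  apply: ler_sum => i _; rewrite ler_wpM2l//.
  apply: le_trans (ler_norm _) _; rewrite dotvC.
  by case: (y_sign i) => ->; rewrite ?mul1r ?mulN1r ?normrN norm_dotv_le.
have := norm2_ge0 (w 1%N); rewrite -sqr_norm2; nra.
Qed.

(** For [t >= 1], [(t + 1)^2 / 8 <= t (t + 1) / 4]; at [t = 0] the weight [tri 0] vanishes and [w 1]
    contributes at most [1 / 8]. *)
Lemma stability_le : \sum_(0 <= t < T) t.+1%:R ^+ 2 / 8
      * dotv (w t.+1 - w t) (w t.+1 - w t)
  <= \sum_(0 <= t < T) tri R t / 2 * dotv (w t.+1 - w t) (w t.+1 - w t) + 1 / 8.
Proof.
rewrite -(prednK T_gt0) !(big_ltn (ltn0Sn _)) /=.
rewrite w0 subr0 /tri !mul0r add0r addrC; apply: lerD; last first.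
  by have := norm_w1_le; lra.
apply: ler_sum_nat => t /andP[t0 _]; rewrite ler_wpM2r ?dotvv_ge0//.
have : (1 : R) <= t%:R by rewrite ler1n.
by rewrite -natr1; nra.
Qed.

Lemma wsum_margin i : gamma * norm2 (wsum w T) - 4 * ln n%:R - 1 / 8
  <= y i * dotv (wsum w T) (x i).
Proof.
set B := wsum w T; have S0 := tri_gt0 R T_gt0.
have lo := ln_exp_risk_ge_margin x y n_gt0 (s T) i.
have hi := ln_exp_risk_le (leqnn T).
have btl := be_the_leader game_w.
have sq := sum_sqr_w_ge; have st := stability_le.
(* With this scale the quadratic loss of [k *: wstar] equals the lower bound in [sq], so the two
   cancel and only [gamma * norm2 B] remains. *)
pose k := norm2 B / tri R T.
have k0 : 0 <= k by rewrite divr_ge0 ?norm2_ge0// ltW.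
have opt : w_obj A p T (w T) <= w_obj A p T (k *: wstar).
  by case: T T_gt0 w_min => // t _; apply.
rewrite [in leRHS]w_objE !(dotvZl, dotvZr) -(sqr_norm2 wstar) wstar1 in opt.
have pw : k * (tri R T * gamma) <= k * dotv (pull A p T) wstar.
  by rewrite ler_wpM2l// pull_wstar.
have kE : tri R T * k = norm2 B by rewrite /k mulrC divfK// gt_eqF.
rewrite -/B -sqr_norm2 in sq.
have sqE : norm2 B ^+ 2 / (2 * tri R T) = norm2 B * k / 2.
  by rewrite /k; field; rewrite gt_eqF.
rewrite sumrB in hi.
rewrite big_split/= in btl.
have btl1 : \sum_(0 <= t < T) t.+1%:R * (dotv (w t.+1) (w t.+1) / 2 -
     dotv (p t.+1 *m A) (w t.+1)) =
   \sum_(0 <= t < T) t.+1%:R * (dotv (w t.+1) (w t.+1) / 2) -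
   \sum_(0 <= t < T) t.+1%:R * dotv (p t.+1 *m A) (w t.+1).
  by rewrite -sumrB; apply: eq_bigr => t _; rewrite mulrBr.
have hi1 : \sum_(0 <= t < T) t.+1%:R ^+ 2 / 32 *
    dotv (w t.+1 - w t) (w t.+1 - w t) = 4^-1 * \sum_(0 <= t < T) t.+1%:R ^+ 2 / 8
      * dotv (w t.+1 - w t) (w t.+1 - w t).
  by rewrite mulr_sumr; apply: eq_bigr => t _; field.
have hi2 : \sum_(0 <= t < T) t.+1%:R / 4 * dotv (p t.+1 *m A) (w t.+1) =
    4^-1 * \sum_(0 <= t < T) t.+1%:R * dotv (p t.+1 *m A) (w t.+1).
  by rewrite mulr_sumr; apply: eq_bigr => t _; field.
rewrite hi1 hi2 in hi; rewrite btl1 in btl; rewrite sqE in sq.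
rewrite /s dotvZl -/B in lo.
have e1 : tri R T / 2 * (k * (k * 1 ^+ 2)) = norm2 B * k / 2.
  by rewrite -kE; field.
have e2 : k * (tri R T * gamma) = gamma * norm2 B by rewrite -kE; ring.
rewrite e1 in opt; rewrite e2 in pw.
lra.
Qed.

Lemma margin_bound q : in_simplex q ->
  gamma - (8 * ln n%:R + 2) / (T%:R * (T.+1)%:R * gamma)
    <= pAw A q (s T) / norm2 (s T).
Proof.
move=> [q0 q1]; have S0 := tri_gt0 R T_gt0.
set B := wsum w T; have Bge := wsum_norm_ge; rewrite -/B in Bge.
have Sg0 : 0 < tri R T * gamma by rewrite mulr_gt0.
have B0 : 0 < norm2 B by apply: lt_le_trans Bge.
have ln0 : 0 <= ln (n%:R : R) by rewrite ln_ge0// ler1n.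
have M : gamma * norm2 B - 4 * ln n%:R - 1 / 8 <= dotv (q *m A) B.
  set c := leLHS.
  rewrite dotv_mul_Amat -[c]mul1r -q1 mulr_suml; apply: ler_sum => i _.
  by rewrite ler_wpM2l//; exact: wsum_margin.
rewrite -[pAw _ _ _]/(dotv (q *m A) (s T)) /s dotvZr norm2Z//.
have -> : 4^-1 * dotv (q *m A) B / (4^-1 * norm2 B) = dotv (q *m A) B / norm2 B.
  by field; rewrite gt_eqF.
have -> : (8 * ln n%:R + 2) / (T%:R * T.+1%:R * gamma) =
    (4 * ln n%:R + 1) / (tri R T * gamma).
  rewrite /tri; field; rewrite gt_eqF//= !pnatr_eq0 -lt0n T_gt0.
  by rewrite -[1 + _]/(1%:R + T%:R) -natrD pnatr_eq0.
rewrite ler_pdivlMr// mulrBl.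
apply: le_trans M; rewrite -addrA lerD2l -opprD lerN2.
(* The constant [1 / 8] is relaxed to 1; then [norm2 B >= tri T * gamma] concludes. *)
apply: (@le_trans _ _ (4 * ln n%:R + 1)); first by lra.
rewrite mulrAC ler_pdivlMr// ler_wpM2l//; lra.
Qed.

End Margin.

Unset Implicit Arguments.

Theorem theorem6 (R : realType) (n d : nat)
  (x : 'I_n -> 'rV[R]_d) (y : 'I_n -> R) (wstar : 'rV[R]_d) (gamma : R)
  (T : nat)
  (p : nat -> 'rV[R]_n) (w : nat -> 'rV[R]_d) :
  (forall i, norm2 (x i) <= 1) ->
  (forall i, y i = 1 \/ y i = -1) ->
  norm2 wstar = 1 ->
  (forall i, gamma <= y i * dotv (x i) wstar) ->
  (exists i, y i * dotv (x i) wstar = gamma) ->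
  0 < gamma ->
  (0 < T)%N ->
  w 0%N = 0 ->
  (forall t, (1 <= t <= T)%N ->
     in_simplex (p t) /\
     (forall q, in_simplex q ->
        p_obj (Amat x y) w t (p t) <= p_obj (Amat x y) w t q)) ->
  (forall t, (1 <= t <= T)%N ->
     forall v, w_obj (Amat x y) p t (w t) <= w_obj (Amat x y) p t v) ->
  let sT := (nag x y T).2 in
  sT = wtilde w T /\
  (forall q, in_simplex q ->
     gamma - (8 * ln n%:R + 2) / (T%:R * (T.+1)%:R * gamma)
       <= pAw (Amat x y) q sT / norm2 sT).
Proof.
move=> x1 y1 ws1 marg [i0 _] g0 T0 w0 pP wP.
(* The index attaining the margin shows that the sample is nonempty. *)
have n0 : (0 < n)%N by case: n i0 {x y p x1 y1 marg pP wP} => // -[].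
have p_simplex t : (t < T)%N -> in_simplex (p t.+1).
  by move=> tT; have [] := pP t.+1 tT.
have p_min t : (t < T)%N -> forall q, in_simplex q ->
    p_obj (Amat x y) w t.+1 (p t.+1) <= p_obj (Amat x y) w t.+1 q.
  by move=> tT; have [] := pP t.+1 tT.
have w_min t : (t < T)%N -> forall v,
    w_obj (Amat x y) p t.+1 (w t.+1) <= w_obj (Amat x y) p t.+1 v.
  by move=> tT; exact: wP.
have sE : (nag x y T).2 = 4^-1 *: wsum w T.
  by rewrite (nag_game n0 w0 p_simplex p_min w_min (leqnn T)).
rewrite /= sE; split; last first.
  exact: (margin_bound n0 x1 y1 w0 p_simplex p_min w_min ws1 marg g0 T0).
rewrite /wtilde /wbar /alpha sum_natr scalerA; congr (_ *: _).
by field; rewrite gt_eqF// tri_gt0.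
Qed.
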